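(* Let $(\mathcal{E},\mathcal{F})$ be a regular Dirichlet form in $L^{2}(M,\mu)$ without killing part. If conditions $(\mathrm{wEH})$ (with constant $\sigma$) and $(\mathrm{TJ})$, defined in the context, hold, then there exist three constants $C>0$, $\theta\in(0,1]$ and $\varepsilon\in(0,1)$ such that, for any ball $B(x_0,r)$ with $r<\sigma\overline R$ and for any globally bounded function $u$ which is harmonic in $B(x_0,r)$, $$|u(x)-u(y)|\le C\Big(\frac{d(x,y)}{r}\Big)^{\theta}\|u\|_{L^\infty}$$ for $\mu$-almost all points $x,y\in B(x_0,\varepsilon r)$.
   Context: Metric measure space: $(M,d)$ is a locally compact separable metric space, $\mu$ a Radon measure on $M$ with full support, $B(x,r)=\{y\in M:d(x,y)<r\}$. Every ball is assumed precompact and comes with a fixed centre and radius; for $B=B(x,r)$ and $\lambda>0$, $\lambda B=B(x,\lambda r)$. $\overline R\in(0,\mathrm{diam}(M)]$ is fixed (possibly $\infty$). The map $w:M\times[0,\infty)\to[0,\infty)$ is such that $w(x,\cdot)$ is continuous, strictly increasing, $w(x,0)=0$ for each $x$, and there are constants $C_1,C_2>0$, $\beta_2\ge\beta_1>0$ with $C_1(R/r)^{\beta_1}\le w(x,R)/w(y,r)\le C_2(R/r)^{\beta_2}$ for all $0<r\le R<\infty$ and $x,y\in M$ with $d(x,y)\le R$. For $B=B(x,R)$ write $w(B)=w(x,R)$. Ess inf, ess sup are with respect to $\mu$. Dirichlet form: $(\mathcal E,\mathcal F)$ is regular without killing part: $\mathcal E=\mathcal E^{(L)}+\mathcal E^{(J)}$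 with $\mathcal E^{(L)}$ strongly local and $\mathcal E^{(J)}(u,u)=\iint_{M\times M\setminus\mathrm{diag}}(u(x)-u(y))^2J(dx,dy)$, $J$ the (symmetric Radon) jump measure, set to $0$ on the diagonal. $\mathcal F'=\{v+a:v\in\mathcal F,a\in\mathbb R\}$, $\mathcal E(u+a,v+b):=\mathcal E(u,v)$ for $u,v\in\mathcal F$, $a,b\in\mathbb R$. For open $\Omega\subset M$, $\mathcal F(\Omega)$ is the closure of $\mathcal F\cap C_0(\Omega)$ in the norm $\sqrt{\mathcal E(u,u)+\|u\|_2^2}$, $C_0(\Omega)$ being the continuous functions with compact support in $\Omega$. A function $u\in\mathcal F$ is harmonic in $\Omega$ if $\mathcal E(u,\varphi)=0$ for all $0\le\varphi\in\mathcal F(\Omega)$. A function $u\in\mathcal F'$ is $f$-superharmonic in $\Omega$ if $\mathcal E(u,\varphi)\ge(f,\varphi)$ for all $0\le\varphi\in\mathcal F(\Omega)$. $(\mathrm{TJ})$: there is a transition kernel $J(x,E)$ on $M\times\mathcal B(M)$ and a constant $C\ge0$ such that $J(dx,dy)=J(x,dy)\mu(dx)$ and $J(x,B(x,R)^c)\le C/w(x,R)$ for all $x\in M$, $R>0$. For open $U\Subset\Omega$, $T_{U,\Omega}(v)=\operatorname{ess\,sup}_{x\in U}\int_{\Omega^c}|v(y)|J(x,dy)$; $u_-=\max(0,-u)$. $(\mathrm{wEH})$: there exist constants $p,\delta,\sigma\in(0,1)$ and $C_H\ge1$ such that for all concentric balls $B_r=B(x_0,r)\subset B_R=B(x_0,R)$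 with $0<r\le\delta R$, $R<\sigma\overline R$, every $f\in L^\infty(B_R)$ and every $u\in\mathcal F'\cap L^\infty$ non-negative and $f$-superharmonic in $B_R$, $\big(\frac1{\mu(B_r)}\int_{B_r}u^pd\mu\big)^{1/p}\le C_H\big(\operatorname{ess\,inf}_{B_r}u+w(B_r)(T_{\frac34B_R,B_R}(u_-)+\|f\|_{L^\infty(B_R)})\big)$. *)

(* Defs.v *)
From HB Require Import structures.
From mathcomp Require Import all_boot all_order all_algebra.
From mathcomp Require Import all_classical all_reals all_analysis.
From mathcomp Require Import ess_sup_inf hoelder kernel.
Set Implicit Arguments.
Unset Strict Implicit.
Unset Printing Implicit Defensive.
Import Order.TTheory GRing.Theory Num.Theory.
Import numFieldNormedType.Exports.
Local Open Scope classical_set_scope.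
Local Open Scope ring_scope.

HB.mixin Record Metric_isBorel (K : numDomainType) (d : measure_display) M
    & Metric K M & Measurable d M := {
  measurable_borel : @measurable d M = <<s @open M >>
}.

#[short(type="borelMetricType")]
HB.structure Definition BorelMetric (K : numDomainType) (d : measure_display) :=
  { M of Metric K M & Measurable d M & Metric_isBorel K d M }.

Section metric_measure_space.
Context (R : realType) (d : measure_display) (M : borelMetricType R d).
Local Open Scope ereal_scope.

Definition separable_space (T : topologicalType) :=
  exists2 D : set T, countable D & dense D.

(* [nu] is a Radon measure on the open subspace [U] of [T]; [Bo] is meant to be
   the class of Borel sets of [T]. *)
Definition radon_on (T : topologicalType) (Bo : set_system T)
    (nu : set T -> \bar R) (U : set T) :=
  [/\ forall K, compact K -> K `<=` U -> nu K < +oo,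
      forall A, Bo A -> A `<=` U ->
        nu A = ereal_inf [set nu O | O in [set O | [/\ open O, A `<=` O & O `<=` U]]] &
      forall O, open O -> O `<=` U ->
        nu O = ereal_sup [set nu K | K in [set K | compact K /\ K `<=` O]] ].

Definition full_support (mu : {measure set M -> \bar R}) :=
  forall O : set M, open O -> O !=set0 -> 0 < mu O.

Record metric_measure_space (mu : {measure set M -> \bar R}) : Prop := {
  mms_locally_compact : locally_compact [set: M] ;
  mms_separable : separable_space M ;
  mms_radon : radon_on measurable mu [set: M] ;
  mms_full_support : full_support mu ;
  mms_ball_precompact : forall (x : M) (r : R), (0 < r)%R -> precompact (ball x r)
}.

Definition diam : \bar R := ereal_sup [set (mdist z.1 z.2)%:E | z in [set: M * M]].

Local Close Scope ereal_scope.

Record scaling_function (w : M -> R -> R) : Prop := {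
  scaling_ge0 : forall x r, 0 <= r -> 0 <= w x r ;
  scaling_continuous : forall x, {within `[0, +oo[, continuous (w x)} ;
  scaling_increasing : forall x, {in `[0, +oo[ &, {homo w x : r s / r < s}} ;
  scaling_at0 : forall x, w x 0 = 0 ;
  scaling_bounds : exists C1 C2 b1 b2 : R,
    [/\ 0 < C1, 0 < C2, 0 < b1, b1 <= b2 &
      forall (x y : M) (r S : R), 0 < r -> r <= S -> mdist x y <= S ->
        C1 * (S / r) `^ b1 <= w x S / w y r <= C2 * (S / r) `^ b2]
}.

Section essential_bounds.
Context (mu : {measure set M -> \bar R}).

Definition ess_sup_on (U : set M) (f : M -> \bar R) : \bar R :=
  ess_sup mu (patch (cst -oo%E) U f).

Definition ess_inf_on (U : set M) (f : M -> \bar R) : \bar R :=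
  ess_inf mu (patch (cst +oo%E) U f).

End essential_bounds.

(* The elements of L^2(M, mu) are represented by Borel functions; accordingly
   the domain [F] is saturated, and [E] invariant, under mu-a.e. equality. *)
Section dirichlet_form.
Context (mu : {measure set M -> \bar R}).
Implicit Types (F : set (M -> R)) (E : (M -> R) -> (M -> R) -> R).

Definition L2_dot (u v : M -> R) : R := \int[mu]_x (u x * v x).

Definition E1_norm E (u : M -> R) : R := Num.sqrt (E u u + L2_dot u u).

Record ae_domain F : Prop := {
  domain_L2 : forall u, F u -> u \in Lfun mu 2%:E ;
  domain_ae : forall u v, F u -> measurable_fun [set: M] v ->
    u = v %[ae mu] -> F v ;
  domain_0 : F (cst 0) ;
  domain_lin : forall a u v, F u -> F v -> F (fun x => a * u x + v x)
}.

Record symmetric_form F E : Prop := {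
  form_ae : forall u v g, F u -> F v -> F g -> u = v %[ae mu] -> E u g = E v g ;
  form_sym : forall u v, F u -> F v -> E u v = E v u ;
  form_lin : forall a u v g, F u -> F v -> F g ->
    E (fun x => a * u x + v x) g = a * E u g + E v g ;
  form_ge0 : forall u, F u -> 0 <= E u u
}.

Record dirichlet_form F E : Prop := {
  df_domain : ae_domain F ;
  df_dense : forall f, f \in Lfun mu 2%:E -> forall e : R, 0 < e ->
    exists2 u, F u & ('N[mu]_2%:E[EFin \o (f \- u)%R] < e%:E)%E ;
  df_form : symmetric_form F E ;
  df_closed : forall u_ : nat -> M -> R, (forall n, F (u_ n)) ->
    (forall e : R, 0 < e -> exists N, forall m n, (N <= m)%N -> (N <= n)%N ->
      E1_norm E (u_ m \- u_ n) < e) ->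
    exists2 u, F u & E1_norm E (u_ n \- u) @[n --> \oo] --> 0 ;
  df_markov : forall u, F u -> let v := fun x => Num.min 1 (Num.max 0 (u x)) in
    F v /\ E v v <= E u u
}.

Definition C0 (Omega : set M) : set (M -> R) :=
  [set f | [/\ continuous f, compact (closure [set x | f x != 0]) &
             closure [set x | f x != 0] `<=` Omega]].

Definition E1_closure F E (S : set (M -> R)) : set (M -> R) :=
  [set u | F u /\ forall e : R, 0 < e -> exists2 g, S g & E1_norm E (u \- g) < e].

Definition domain_on F E (Omega : set M) : set (M -> R) :=
  E1_closure F E (F `&` C0 Omega).

Definition regular_form F E :=
  F `<=` E1_closure F E (F `&` C0 [set: M]) /\
  forall f, C0 [set: M] f -> forall e : R, 0 < e ->
    exists2 g, (F `&` C0 [set: M]) g & forall x, `|f x - g x| < e.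

(* support of the measure |u| dmu *)
Definition ess_support (u : M -> R) : set M :=
  [set x | forall O, open O -> O x -> ~ u = cst 0 %[ae mu in O]].

Definition strongly_local F E :=
  forall u v, F u -> F v -> compact (ess_support u) -> compact (ess_support v) ->
    (exists (O : set M) (c : R),
      [/\ open O, ess_support u `<=` O & v = cst c %[ae mu in O]]) ->
    E u v = 0.

Definition capacity F E (O : set M) : \bar R :=
  ereal_inf [set (E u u + L2_dot u u)%:E | u in
    [set u | F u /\ \forall x \ae mu, O x -> 1 <= u x]].

Definition quasi_continuous F E (u : M -> R) :=
  forall e : R, 0 < e -> exists O : set M,
    [/\ open O, (capacity F E O < e%:E)%E & {within ~` O, continuous u}].

(* The product sigma-algebra of [M * M] is its Borel sigma-algebra as soon as
   [M] is separable. *)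
Definition off_diag : set (M * M) := [set z | z.1 != z.2].

Record jump_measure (J : {measure set (M * M) -> \bar R}) : Prop := {
  jump_radon : @radon_on (M * M)%type (@measurable _ (M * M)%type) J off_diag ;
  jump_sym : forall A, measurable A -> J [set z | A (z.2, z.1)] = J A ;
  jump_diag : J (~` off_diag) = 0%E
}.

(* Beurling-Deny decomposition with no killing measure. As [J] may charge
   mu-null sets, E^(J) is evaluated at quasi-continuous versions. *)
Definition without_killing F E (J : {measure set (M * M) -> \bar R}) :=
  jump_measure J /\
  exists EL, [/\ symmetric_form F EL, strongly_local F EL &
    forall u, F u -> quasi_continuous F E u ->
      (E u u)%:E = ((EL u u)%:E +
        \int[J]_(z in off_diag) ((u z.1 - u z.2) ^+ 2)%:E)%E].

Definition harmonic_in F E (Omega : set M) (u : M -> R) :=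
  F u /\ forall phi, domain_on F E Omega phi ->
    (\forall x \ae mu, 0 <= phi x) -> E u phi = 0.

(* [u = v + a] is an element of F', for which E(v + a, phi) := E(v, phi). The
   pairing (f, phi) is taken over [Omega], outside of which phi vanishes a.e. *)
Definition superharmonic_in F E (f : M -> R) (Omega : set M) (u : M -> R) :=
  exists (v : M -> R) (a : R), [/\ F v, u = (fun x => v x + a) &
    forall phi, domain_on F E Omega phi -> (\forall x \ae mu, 0 <= phi x) ->
      \int[mu]_(x in Omega) (f x * phi x) <= E v phi].

End dirichlet_form.

Section conditions.
Context (mu : {measure set M -> \bar R}).
Implicit Types (F : set (M -> R)) (E : (M -> R) -> (M -> R) -> R).
Implicit Types (w : M -> R -> R) (k : R.-ker M ~> M).

Definition TJ w (J : {measure set (M * M) -> \bar R}) k :=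
  (forall A, measurable A -> J A = \int[mu]_x k x (xsection A x))%E /\
  exists2 C : R, 0 <= C &
    forall x r, 0 < r -> (k x (~` ball x r) <= (C / w x r)%:E)%E.

Definition tail k (U Omega : set M) (v : M -> R) : \bar R :=
  ess_sup_on mu U (fun x => \int[k x]_(y in ~` Omega) (`|v y|)%:E)%E.

Definition neg_part (u : M -> R) (x : M) : R := Num.max 0 (- u x).

Definition wEH F E w k (Rbar : \bar R) (sigma : R) :=
  0 < sigma < 1 /\
  exists p delta CH : R, [/\ 0 < p < 1, 0 < delta < 1, 1 <= CH &
    forall (x0 : M) (r S : R), 0 < r -> r <= delta * S ->
      (S%:E < sigma%:E * Rbar)%E ->
    forall f u : M -> R, f \_ (ball x0 S) \in Lfun mu +oo%E ->
      u \in Lfun mu +oo%E ->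
      (\forall x \ae mu, ball x0 S x -> 0 <= u x) ->
      superharmonic_in mu F E f (ball x0 S) u ->
    (((mu (ball x0 r))^-1 * \int[mu]_(x in ball x0 r) (u x `^ p)%:E) `^ p^-1%R
     <= CH%:E * (ess_inf_on mu (ball x0 r) (EFin \o u) +
          (w x0 r)%:E *
            (tail k (ball x0 (3 / 4 * S)) (ball x0 S) (neg_part u) +
             'N[mu]_+oo[EFin \o (f \_ (ball x0 S))])))%E].

End conditions.
End metric_measure_space.

(* Main.v *)
Require Import Defs.
From mathcomp Require Import all_boot all_order all_algebra.
From mathcomp Require Import all_classical all_reals all_analysis.
From mathcomp Require Import ess_sup_inf hoelder kernel measurable_realfun.
From mathcomp Require Import ring lra.
Import Order.TTheory GRing.Theory Num.Theory.
Import numFieldNormedType.Exports.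
Local Open Scope classical_set_scope.
Local Open Scope ring_scope.
Set Implicit Arguments.
Unset Strict Implicit.
Unset Printing Implicit Defensive.

(** Hölder continuity follows from a geometric decay of oscillation, and the weak
    elliptic Harnack inequality provides that decay.

    Let [u] be harmonic in [B(x0, r)] with [|u| <= L], take [B(z, S)] inside
    [B(x0, r)] and shrink it by a fixed factor [h]: [B_j = B(z, S h^j)].  Suppose
    that [m <= u <= m + D] on [B_n].  Then [u - m] and [m + D - u] are both
    nonnegative and superharmonic on [B_n] and their sum is [D]; hence one of them
    has a p-average of at least [c D] over [B_(n+1)] ([lower_power_average]).
    Were there no tail term, the Harnack inequality would bound this function from
    below by a multiple of [D] on [B_(n+1)], so that the oscillation on [B_(n+1)]
    would be at most [e D] for a fixed [e < 1].

    The tail term is where the global behaviour of [u] enters, because the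
    function need not be nonnegative outside [B_n].  The induction therefore keeps
    the earlier bounds too: on [B_j], [j <= n], the negative part is at most
    [D_j = A e^j] ([oscillation_bound]).  By condition (TJ) and the growth
    of [w], the kernel mass of the shell between [B_j] and [B_(j+1)] times
    [w(B_(n+1))] is of order [a^(n-j)] with [a = h^b], so that the tail term is at
    most a constant times [A sum_(j < n) e^j a^(n-j) <= 4 a A e^n]
    ([tail_shrinking]).  The gain [1 - e]
    depends only on the constants of the Harnack inequality, so [h] can be taken
    so small afterwards that the tail uses up at most half of what the average
    provides ([ratio_choice]).

    The bounds on [B_j] hold only mu-almost everywhere, whereas the tail integrates
    against the kernel [J(x, .)].  Symmetry of the jump measure makes every mu-null
    set null for [J(x, .)] for mu-almost every [x] ([jump_kernel_negligible]).

    Finally [e = h^g] for some [g] in [(0, 1]], which turns the decay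
    [osc_(B_n) u <= A e^n] into a Hölder bound of exponent [g]; the exceptional null
    set is made independent of the centre [z] by letting [z] range over a countable
    dense set ([hoelder_of_decay]). *)

(** * Weights of the shells *)

(** The factor [4] and the bound [a <= 1 / 4 <= e / 2] are chosen so that the
    bound reproduces itself: passing from [n] to [n + 1] multiplies the sum plus
    its new term by [a], and the sum before is at most [e ^+ n]. *)
Lemma sum_geometric_weights (R : realFieldType) (a e : R) (n : nat) :
  0 <= a <= 1 / 4 -> 1 / 2 <= e <= 1 ->
  \sum_(j < n) e ^+ j * a ^+ (n - j) <= 4 * a * e ^+ n.
Proof.
move=> /andP[a0 a4] /andP[e2 e1].
have e0 : 0 <= e by lra.
elim: n => [|n IH]; first by rewrite big_ord0 !mulr_ge0 ?exprn_ge0//; lra.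
have -> : \sum_(j < n.+1) e ^+ j * a ^+ (n.+1 - j) =
    a * (\sum_(j < n) e ^+ j * a ^+ (n - j) + e ^+ n).
  rewrite big_ord_recr /= subSnn expr1 mulrDr mulr_sumr [a * e ^+ n]mulrC.
  congr (_ + _); apply: eq_bigr => j _.
  by rewrite subSn ?(ltnW (ltn_ord j))// exprS; ring.
have En : 0 <= e ^+ n by rewrite exprn_ge0.
rewrite exprS; apply: (@le_trans _ _ (a * (2 * e ^+ n))); last first.
  by have := mulr_ge0 a0 En; nra.
by rewrite ler_wpM2l//; nra.
Qed.

(** * Balls *)

Section metric.
Context (R : realType) (d : measure_display) (M : borelMetricType R d).
Implicit Types (x y z : M) (r s : R).

Lemma open_mball x r : open (ball x r).
Proof.
rewrite openE ballEmdist => y /= xy.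
apply/nbhs_ballP; exists (r - mdist x y) => /=; first by rewrite subr_gt0.
move=> z; rewrite ballEmdist /= => yz.
by have := metric_triangle x y z; lra.
Qed.

Lemma measurable_mball x r : measurable (ball x r).
Proof.
by rewrite measurable_borel; apply: sub_sigma_algebra; exact: open_mball.
Qed.

Lemma sub_mball x y r s : mdist y x + r <= s -> ball x r `<=` ball y s.
Proof.
move=> h z; rewrite !ballEmdist /= => xz.
by have := metric_triangle y x z; lra.
Qed.

Context (mu : {measure set M -> \bar R}).
Context (hM : metric_measure_space mu).

Lemma mu_mball_gt0 x r : 0 < r -> (0 < mu (ball x r))%E.
Proof.
move=> r0; apply: (mms_full_support hM); first exact: open_mball.
by exists x; exact: ballxx.
Qed.

Lemma mu_mball_lty x r : 0 < r -> (mu (ball x r) < +oo)%E.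
Proof.
move=> r0; have [+ _ _] := mms_radon hM.
have := mms_ball_precompact hM x r0; rewrite precompactE => cB.
move=> /(_ _ cB) /(_ (@subsetT _ _)); apply: le_lt_trans.
apply: le_measure; rewrite ?inE; first exact: measurable_mball.
  rewrite -[closure _]setCK; apply: measurableC.
  rewrite measurable_borel; apply: sub_sigma_algebra.
  exact/closed_openC/closed_closure.
exact: subset_closure.
Qed.

End metric.

(** * Averages and integrals over shells *)

Section averages.
Context d (T : measurableType d) (R : realType) (mu : {measure set T -> \bar R}).
Local Open Scope ereal_scope.

(** At almost every point one of the two functions is at least [D / 2], so their p-th
    powers add up to at least [(D / 2)^p] and one of the two has at least half of
    the total integral.  This holds for every [p > 0], including [p < 1] where the
    power is not convex. *)
Lemma lower_power_average (B : set T) (v1 v2 : T -> R) (D p : R) :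
  (0 < p)%R -> (0 <= D)%R -> measurable B -> 0 < mu B -> mu B < +oo ->
  measurable_fun setT v1 -> measurable_fun setT v2 ->
  (\forall x \ae mu, B x -> (D <= v1 x + v2 x)%R) ->
  exists2 v, v = v1 \/ v = v2 &
    ((1 / 2 * (1 / 2) `^ p^-1 * D)%R)%:E <=
      ((mu B)^-1 * \int[mu]_(x in B) (v x `^ p)%:E) `^ p^-1.
Proof.
move=> p0 D0 mB B0 Boo m1 m2 hD.
have mpow (v : T -> R) : measurable_fun setT v ->
    measurable_fun B (EFin \o (fun x => v x `^ p)%R).
  move=> mv; apply/measurable_EFinP; apply: measurable_funTS.
  exact: (measurableT_comp (measurable_powR p) mv).
have pge0 (v : T -> R) x : B x -> 0 <= (v x `^ p)%:E by rewrite lee_fin powR_ge0.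
set I := fun v : T -> R => \int[mu]_(x in B) (v x `^ p)%:E.
set q := ((D / 2) `^ p)%R.
have sumI : q%:E * mu B <= I v1 + I v2.
  rewrite -integral_cst// -ge0_integralD//; [|exact: pge0|exact: mpow|exact: pge0|exact: mpow].
  apply: ae_ge0_le_integral => //.
  - by move=> x _; rewrite /= lee_fin powR_ge0.
  - by move=> x Bx; rewrite adde_ge0 ?pge0.
  - by apply: emeasurable_funD; exact: mpow.
  apply: filterS hD => x /[swap] Bx /(_ Bx) Dv /=.
  rewrite -EFinD lee_fin.
  have [h|h] := leP (D / 2)%R (v1 x).
    rewrite -[leLHS]addr0 lerD ?powR_ge0// ge0_ler_powR ?nnegrE ?(ltW p0)//; lra.
  rewrite -[leLHS]add0r lerD ?powR_ge0// ge0_ler_powR ?nnegrE ?(ltW p0)//; lra.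
have [v vE hv] : exists2 v, v = v1 \/ v = v2 & (q / 2)%:E * mu B <= I v.
  have [h|h] := leP ((q / 2)%:E * mu B) (I v1); first by exists v1; [left|].
  exists v2; first by right.
  rewrite leNgt; apply/negP => h2; have := lteD h h2.
  rewrite -ge0_muleDl ?lee_fin ?divr_ge0 ?powR_ge0//.
  by rewrite -EFinD -splitr ltNge sumI.
exists v => //.
have mBE : mu B = (fine (mu B))%:E by rewrite fineK// ge0_fin_numE// ltW.
have mB0 : (0 < fine (mu B))%R by rewrite -lte_fin -mBE.
have -> : (1 / 2 * (1 / 2) `^ p^-1 * D)%:E = (q / 2)%:E `^ p^-1.
  rewrite poweR_EFin powRM ?powR_ge0// -powRrM mulfV ?gt_eqF// powRr1 ?divr_ge0//.
  by rewrite mul1r; congr EFin; ring.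
apply: gt0_ler_poweR.
- by rewrite invr_ge0 ltW.
- by rewrite in_itv/= leey lee_fin divr_ge0 ?powR_ge0.
- rewrite in_itv/= leey andbT mule_ge0 ?inve_ge0 ?(ltW B0)//.
  by apply: integral_ge0; exact: pge0.
have -> : (mu B)^-1 = ((fine (mu B))^-1)%:E.
  by rewrite {1}mBE inver gt_eqF.
by rewrite lee_pdivlMl// muleC -mBE.
Qed.

(** Splitting the complement of [B n] into the shells [B j `\` B j.+1] uses the
    bound [D j] on the [j]-th shell only, and each shell weighs at most as much as
    the complement of [B j.+1]. *)
Lemma integral_shells (B : nat -> set T) (v : T -> R) (D c : nat -> R) n :
  (forall j, measurable (B j)) -> B 0%N = setT -> measurable_fun setT v ->
  (forall j, 0 <= D j)%R ->
  (\forall x \ae mu, forall j, (j < n)%N -> B j x -> (`|v x| <= D j)%R) ->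
  (forall j, (j < n)%N -> mu (~` B j.+1) <= (c j)%:E) ->
  \int[mu]_(x in ~` B n) `|v x|%:E <= (\sum_(j < n) (D j * c j)%R)%:E.
Proof.
move=> mB B0 mv D0.
have mvE A : measurable_fun A (EFin \o (fun x => `|v x|)%R).
  by apply/measurable_EFinP/measurable_funTS/measurableT_comp.
elim: n => [|n IH] hv hc.
  by rewrite B0 setCT integral_set0 big_ord0.
rewrite big_ord_recr /= EFinD.
have mC j : measurable (~` B j) by exact: measurableC.
have sub : ~` B n.+1 `<=` ~` B n `|` (B n `&` ~` B n.+1).
  by move=> x nx; have [bx|bx] := pselect (B n x); [right|left].
have mI : measurable (B n `&` ~` B n.+1) by exact: measurableI.
apply: (@le_trans _ _ (\int[mu]_(x in ~` B n `|` (B n `&` ~` B n.+1)) `|v x|%:E)).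
  by apply: ge0_subset_integral => //; exact: measurableU.
rewrite ge0_integral_setU//; last first.
  by apply/disj_setPS => x [] /= nb [].
apply: leeD.
  apply: IH => [|j jn]; last by apply: hc; exact: ltnW.
  by apply: filterS hv => x hx j jn; apply: hx; exact: ltnW.
have := @integral_le_bound _ _ _ mu (B n `&` ~` B n.+1) (fun x => (v x)%:E) (D n)%:E.
move=> /(_ mI) h; apply: le_trans (h _ _ _) _.
- exact/measurable_EFinP/measurable_funTS.
- by rewrite lee_fin.
- by apply: filterS hv => x hx [bx _]; rewrite /= lee_fin; exact: hx.
rewrite EFinM lee_wpmul2l ?lee_fin//; apply: le_trans (hc n (ltnSn n)).
by apply: le_measure; rewrite ?inE.
Qed.
End averages.

(** * Null sets of the jump kernel *)

Section kernel_null.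
Context (R : realType) (d : measure_display) (M : borelMetricType R d).
Context (mu : {measure set M -> \bar R}) (J : {measure set (M * M) -> \bar R}).
Context (k : R.-ker M ~> M).
Local Open Scope ereal_scope.

(** By symmetry [J (M x N) = J (N x M)], and the latter is the integral of
    [J(x, M)] over the null set [N]; so [J(x, N)] integrates to zero. *)
Lemma jump_kernel_negligible (N : set M) : jump_measure J ->
  (forall A, measurable A -> J A = \int[mu]_x k x (xsection A x)) ->
  mu.-negligible N -> \forall x \ae mu, (k x).-negligible N.
Proof.
move=> hJ hk [A [mA A0 NA]].
have mTA : measurable ([set: M] `*` A) by exact: measurableX.
have JTA : J ([set: M] `*` A) = 0.
  rewrite -(jump_sym hJ)// (_ : [set z | _] = A `*` [set: M]); last first.
    by apply/seteqP; split => -[x y] /= [].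
  rewrite hk; last exact: measurableX.
  have -> : (fun x => k x (xsection (A `*` [set: M]) x)) =
            (fun x => k x [set: M]) \_ A.
    apply/funext => x; rewrite patchE.
    case: ifPn => xA; first by rewrite in_xsectionX.
    by rewrite notin_xsectionX// measure0.
  rewrite -integral_mkcond (ae_eq_integral (cst 0))//; first exact: integral0.
  - by apply: measurable_funTS; exact: measurable_kernel.
  - exact: ae_eq0.
have : \int[mu]_x `|k x A| = 0.
  rewrite -JTA hk//; apply: eq_integral => x _.
  by rewrite in_xsectionX ?inE// gee0_abs.
move/(ae_eq_integral_abs mu measurableT (measurable_kernel k A mA)).
apply: filterS => x /= /(_ I) kx0.
by exists A.
Qed.

End kernel_null.

(** * Essentially bounded functions *)

Section bounded_functions.
Context d (T : measurableType d) (R : realType) (mu : {measure set T -> \bar R}).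

Lemma Lfun_ooP (u : T -> R) : u \in Lfun mu +oo%E <->
  measurable_fun setT u /\ ('N[mu]_+oo[EFin \o u] < +oo)%E.
Proof.
split=> [|[mu_ fu]].
  by rewrite inE => /andP[] /set_mem ? /set_mem.
by rewrite inE; apply/andP; split; apply: mem_set.
Qed.

Lemma ae_le_Lnorm_oo (u : T -> R) : u \in Lfun mu +oo%E ->
  \forall x \ae mu, `|u x| <= fine 'N[mu]_+oo[EFin \o u]%E.
Proof.
move=> /Lfun_ooP[_ Nfin].
have NE : 'N[mu]_+oo[EFin \o u]%E = (fine 'N[mu]_+oo[EFin \o u])%:E.
  by rewrite fineK// ge0_fin_numE// Lnorm_ge0.
(* on a space of measure zero the norm is 0 by convention *)
have [T0|T0] := boolP (0 < mu [set: T])%E.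
  have : \forall x \ae mu, ((abse \o (EFin \o u)) x <= 'N[mu]_+oo[EFin \o u])%E.
    by apply/ess_supP; rewrite unlock T0.
  by apply: filterS => x; rewrite NE /= lee_fin.
exists setT; split => //.
by apply/eqP; rewrite eq_le measure_ge0 andbT leNgt.
Qed.

Lemma Lfun_oo_bounded (u : T -> R) (c : R) : measurable_fun setT u ->
  (\forall x \ae mu, `|u x| <= c) -> u \in Lfun mu +oo%E.
Proof.
move=> mu_ hc; apply/Lfun_ooP; split => //; rewrite unlock; case: ifP => // T0.
apply: (@le_lt_trans _ _ c%:E); last exact: ltry.
by apply/ess_supP; apply: filterS hc => x /=; rewrite lee_fin.
Qed.

Lemma Lfun_oo_affine (s m : R) (u : T -> R) : `|s| <= 1 -> u \in Lfun mu +oo%E ->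
  (fun x => s * u x + m) \in Lfun mu +oo%E.
Proof.
move=> s1 hu; have [mu_ _] := (Lfun_ooP u).1 hu.
apply: (@Lfun_oo_bounded _ (fine 'N[mu]_+oo[EFin \o u]%E + `|m|)).
  apply: measurable_funD => //; apply: measurable_funM => //.
apply: filterS (ae_le_Lnorm_oo hu) => x ux.
rewrite (le_trans (ler_normD _ _))// lerD2r normrM (le_trans _ ux)//.
by rewrite ler_piMl.
Qed.
End bounded_functions.

(** * Affine images of harmonic functions *)

Section harmonic.
Context (R : realType) (d : measure_display) (M : borelMetricType R d).
Context (mu : {measure set M -> \bar R}) (F : set (M -> R)).
Context (E : (M -> R) -> (M -> R) -> R).

Lemma domain_onS (A B : set M) : A `<=` B ->
  domain_on mu F E A `<=` domain_on mu F E B.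
Proof.
move=> AB phi [Fphi app]; split => // e /app[g [Fg [cg kg sg]] ge].
by exists g => //; split => //; split => //; exact: subset_trans AB.
Qed.

(** The form ignores additive constants, and for a harmonic function the sign of
    the scalar [s] does not matter: [u - m] and [m + D - u] are both covered. *)
Lemma harmonic_superharmonic (A B : set M) (u : M -> R) (s m : R) :
  ae_domain mu F -> Defs.symmetric_form mu F E -> A `<=` B ->
  harmonic_in mu F E B u ->
  superharmonic_in mu F E (cst 0) A (fun x => s * u x + m).
Proof.
move=> hF hE AB [Fu hu].
have F0 := domain_0 hF.
exists (fun x => s * u x + cst 0 x), m; split.
- exact: (domain_lin hF).
- by apply/funext => x /=; rewrite addr0.
move=> phi /[dup] dphi /(domain_onS AB) /hu h /h Eu.
have Fphi : F phi by case: dphi.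
rewrite (form_lin hE)// Eu mulr0 add0r.
have E00 := form_lin hE 1 F0 F0 Fphi.
have E0 : E (cst 0) phi = 0.
  move: E00; rewrite (_ : (fun x => _) = cst 0); first lra.
  by apply/funext => x /=; rewrite mulr0 addr0.
rewrite E0 (_ : (fun x => _) = (fun=> 0)).
  by rewrite /Rintegral integral0.
by apply/funext => x /=; rewrite mul0r.
Qed.
End harmonic.

(** * The scaling function *)

Section scaling.
Context (R : realType) (d : measure_display) (M : borelMetricType R d).
Context (w : M -> R -> R).

Lemma scaling_gt0 x r : scaling_function w -> 0 < r -> 0 < w x r.
Proof.
move=> hw r0; rewrite -(scaling_at0 hw x).
by apply: (scaling_increasing hw) => //; rewrite in_itv /= ?lexx ?ltW.
Qed.

(** Two comparisons are needed because the scaling bounds relate distinct centres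
    only when their distance is below the larger radius: first the centre moves
    from [z] to [x] at radius [r], then the radius drops to [r / 4] at [x]. *)
Lemma scaling_ratio : scaling_function w ->
  exists K b : R, [/\ 0 < K, 0 < b & forall (x z : M) (s r : R),
    0 < s -> s <= r -> mdist x z <= r ->
    w z s / w x (r / 4) <= K * (s / r) `^ b].
Proof.
move=> hw; have [C1 [C2 [b1 [b2 [C10 C20 b10 b12 hb]]]]] := scaling_bounds hw.
exists (C2 * 4 `^ b2 / C1), b1; split => //.
  by rewrite divr_gt0// mulr_gt0// powR_gt0.
move=> x z s r s0 sr xz.
have r0 : 0 < r by exact: lt_le_trans sr.
have r40 : 0 < r / 4 by rewrite divr_gt0.
have /andP[lo _] := hb x z s r s0 sr xz.
have /andP[_] := hb x x (r / 4) r r40 ltac:(lra) ltac:(by rewrite mdistxx ltW).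
rewrite (_ : r / (r / 4) = 4); last by rewrite invf_div mulrC divfK ?gt_eqF.
have -> : (s / r) `^ b1 = ((r / s) `^ b1)^-1.
  apply: (@mulIf _ ((r / s) `^ b1)); first by rewrite gt_eqF// powR_gt0// divr_gt0.
  rewrite mulVf ?gt_eqF ?powR_gt0 ?divr_gt0// -powRM ?divr_ge0 ?ltW//.
  by rewrite mulf_div [s * r]mulrC divff ?powR1// gt_eqF// mulr_gt0.
move: lo; set P := (r / s) `^ b1.
have P0 : 0 < P by rewrite powR_gt0// divr_gt0.
have := scaling_gt0 z hw s0; have := scaling_gt0 x hw r0.
have := scaling_gt0 x hw r40.
move: (w z s) (w x r) (w x (r / 4)) => ws wr wq wq0 wr0 ws0 lo hi.
rewrite ler_pdivrMr//.
rewrite ler_pdivlMr// in lo; rewrite ler_pdivrMr// in hi.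
have -> : C2 * 4 `^ b2 / C1 / P * wq = (C2 * 4 `^ b2 * wq) / (C1 * P).
  by field; rewrite !gt_eqF.
by rewrite ler_pdivlMr ?mulr_gt0// mulrC (le_trans lo).
Qed.

End scaling.

(** * Decay of oscillation *)

Section oscillation.
Context (R : realType) (d : measure_display) (M : borelMetricType R d).
Context (mu : {measure set M -> \bar R}) (Rbar : \bar R) (w : M -> R -> R).
Context (F : set (M -> R)) (E : (M -> R) -> (M -> R) -> R).
Context (J : {measure set (M * M) -> \bar R}) (k : R.-ker M ~> M) (sigma : R).

(** Index 0 stands for the whole space, where the global bound on the function
    plays the part of the bound on a ball: the shells with indices [j < n] then
    exhaust the complement of the [n]-th ball. *)
Definition shrinking_ball (z : M) (S h : R) (j : nat) : set M :=
  if j is 0%N then setT else ball z (S * h ^+ j).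

Lemma measurable_shrinking_ball z S h j : measurable (shrinking_ball z S h j).
Proof. by case: j => [|j] /=; [exact: measurableT|exact: measurable_mball]. Qed.

Lemma shrinking_radius_le (S h : R) i j : 0 <= S -> 0 <= h <= 1 -> (i <= j)%N ->
  S * h ^+ j <= S * h ^+ i.
Proof. by move=> S0 /andP[h0 h1] ij; rewrite ler_wpM2l// ler_wiXn2l. Qed.

Lemma expr_powR (h b : R) n : 0 <= h -> (h ^+ n) `^ b = (h `^ b) ^+ n.
Proof. by move=> h0; rewrite -!powR_mulrn ?powR_ge0// powRAC. Qed.

Context (K b CJ h : R).
Context (hw : scaling_function w) (hJ : jump_measure J).
Context (hJk : forall A, measurable A -> J A = (\int[mu]_x k x (xsection A x))%E).
Context (K0 : 0 < K) (CJ0 : 0 <= CJ) (h01 : 0 < h < 1).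
Context (hwK : forall (x z : M) (s r : R), 0 < s -> s <= r -> mdist x z <= r ->
    w z s / w x (r / 4) <= K * (s / r) `^ b).
Context (hCJ : forall x r, 0 < r -> (k x (~` ball x r) <= (CJ / w x r)%:E)%E).

(** A point [x] of the ball of index [n] shrunk by [3 / 4] keeps a distance of a
    quarter of the radius from the complement of each ball of index at most [n], so
    (TJ) applies at [x] with that quarter as radius. *)
Lemma kernel_shrinking_ball z S j n x : 0 < S -> (j < n)%N ->
  ball z (3 / 4 * (S * h ^+ n)) x ->
  (k x (~` shrinking_ball z S h j.+1) <=
   (CJ * K / w z (S * h ^+ n.+1) * (h `^ b) ^+ (n - j))%:E)%E.
Proof.
move=> S0 jn; rewrite ballEmdist /= => zx.
have /andP[h0 h1] := h01.
have pos i : 0 < S * h ^+ i by rewrite mulr_gt0 ?exprn_gt0.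
have rle i i' : (i <= i')%N -> S * h ^+ i' <= S * h ^+ i.
  by apply: shrinking_radius_le; rewrite ?ltW.
have rj := rle _ _ jn; have rj' := rle _ _ (leqW jn).
set r := S * h ^+ j.+1 in rj rj' *.
have r0 : 0 < r := pos _.
apply: (@le_trans _ _ (k x (~` ball x (r / 4)))).
  apply: le_measure; rewrite ?inE; try exact/measurableC/measurable_mball.
  by apply: subsetC; apply: sub_mball; lra.
apply: le_trans (hCJ x _) _; first by rewrite divr_gt0.
rewrite lee_fin -[CJ * K / _]mulrA -[CJ * _ * _]mulrA ler_wpM2l//.
have W0 := scaling_gt0 z hw (pos n.+1).
have := hwK (pos n.+1) rj' (_ : mdist x z <= r).
rewrite metric_sym => /(_ ltac:(by have := pos n; lra)).
have -> : S * h ^+ n.+1 / r = h ^+ (n - j).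
  rewrite /r -mulf_div divff ?gt_eqF// mul1r -expfB ?ltnS//.
rewrite expr_powR; last exact: ltW.
move=> le.
by rewrite [leRHS]mulrAC ler_pdivlMr// mulrC.
Qed.

(** The factor [h `^ b] on the right is what makes the tail negligible against
    the oscillation [A * e ^+ n.+1] once [h] is small. *)
Lemma tail_shrinking z S n (v : M -> R) (A e : R) :
  0 < S -> 0 <= A -> 1 / 2 <= e <= 1 -> h `^ b <= 1 / 4 ->
  measurable_fun setT v ->
  (\forall y \ae mu, forall j, (j < n.+1)%N -> shrinking_ball z S h j y ->
     `|v y| <= A * e ^+ j) ->
  ((w z (S * h ^+ n.+2))%:E *
    tail mu k (ball z (3 / 4 * (S * h ^+ n.+1))) (ball z (S * h ^+ n.+1)) v <=
   (CJ * K * (4 * h `^ b) * (A * e ^+ n.+1))%:E)%E.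
Proof.
move=> S0 A0 e01 a4 mv hv; set W := w _ _; set a := h `^ b in a4 *.
have /andP[h0 h1] := h01.
have W0 : 0 < W by rewrite scaling_gt0// mulr_gt0// exprn_gt0.
have a01 : 0 <= a <= 1 / 4 by rewrite powR_ge0.
have e0 : 0 <= e by lra.
pose Q := \sum_(j < n.+1) A * e ^+ j * (CJ * K / W * a ^+ (n.+1 - j)).
have QE : W * Q = CJ * K * A * \sum_(j < n.+1) e ^+ j * a ^+ (n.+1 - j).
  rewrite /Q !mulr_sumr; apply: eq_bigr => j _.
  by field; rewrite gt_eqF.
have QW : W * Q <= CJ * K * (4 * a) * (A * e ^+ n.+1).
  have := sum_geometric_weights n.+1 a01 e01.
  move=> /(ler_wpM2l (_ : 0 <= CJ * K * A)) => /(_ ltac:(by rewrite !mulr_ge0// ltW)).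
  by rewrite QE => /le_trans; apply; rewrite le_eqVlt; apply/orP; left; apply/eqP; ring.
suff hT : (tail mu k (ball z (3 / 4 * (S * h ^+ n.+1))) (ball z (S * h ^+ n.+1)) v
    <= Q%:E)%E.
  by apply: le_trans (lee_wpmul2l _ hT) _; rewrite lee_fin// ltW.
apply/ess_supP; have := jump_kernel_negligible hJ hJk hv.
apply: filterS => x kx; rewrite /patch; case: ifPn => [/set_mem Ux|_]; last first.
  exact: leNye.
apply: (@integral_shells _ _ _ (k x) (shrinking_ball z S h) v
  (fun j => A * e ^+ j) (fun j => CJ * K / W * a ^+ (n.+1 - j)) n.+1) => //.
- exact: measurable_shrinking_ball.
- by move=> j; rewrite mulr_ge0// exprn_ge0.
- by move=> j jn; exact: kernel_shrinking_ball.
Qed.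

(** The case [f = 0] of the weak Harnack inequality with its constants named. *)
Definition homogeneous_wEH (p delta CH : R) : Prop :=
  forall (z : M) (r s : R), 0 < r -> r <= delta * s ->
    (s%:E < sigma%:E * Rbar)%E ->
  forall v : M -> R, v \in Lfun mu +oo%E ->
    (\forall y \ae mu, ball z s y -> 0 <= v y) ->
    superharmonic_in mu F E (cst 0) (ball z s) v ->
  (((mu (ball z r))^-1 * \int[mu]_(y in ball z r) (v y `^ p)%:E) `^ p^-1%R
   <= CH%:E * (ess_inf_on mu (ball z r) (EFin \o v) +
        (w z r)%:E * tail mu k (ball z (3 / 4 * s)) (ball z s) (neg_part v)))%E.

Lemma wEH_homogeneous : wEH mu F E w k Rbar sigma ->
  exists p delta CH : R, [/\ 0 < p, 0 < delta, 1 <= CH & homogeneous_wEH p delta CH].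
Proof.
move=> [_ [p [delta [CH [/andP[p0 _] /andP[delta0 _] CH1 hH]]]]].
exists p, delta, CH; split => // z r s r0 rs sR v vL v0 vS.
have f0 : (cst 0 : M -> R) \_ (ball z s) = cst 0.
  by apply/funext => y; rewrite patchE; case: ifP.
have N0 : 'N[mu]_+oo[EFin \o (cst 0%R : M -> R)]%E = 0%E by rewrite Lnorm0.
have := hH z r s r0 rs sR (cst 0) v; rewrite f0 N0 adde0; apply => //.
by apply: (Lfun_oo_bounded (c := 0)) => //; apply: aeW => y; rewrite normr0.
Qed.

Context (p delta CH : R).
Context (hM : metric_measure_space mu) (hE : dirichlet_form mu F E).
Context (p0 : 0 < p) (hdelta : h <= delta) (CH1 : 1 <= CH).
Context (hH : homogeneous_wEH p delta CH).

(** The constant of [lower_power_average]: [average_gain * D] bounds one of the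
    two p-averages from below. *)
Definition average_gain : R := 1 / 2 * (1 / 2) `^ p^-1.
(** The Harnack inequality turns an average of [average_gain * D] into a lower
    bound [average_gain / CH * D] minus the tail; half of it is reserved for the
    tail. *)
Definition harnack_gain : R := average_gain / (2 * CH).

Let kappa := harnack_gain.
Let e := 1 - kappa.

Lemma average_gain_bounds : 0 < average_gain <= 1 / 2.
Proof.
have h2 : (1 / 2 : R) `^ p^-1 <= 1 `^ p^-1.
  by rewrite ge0_ler_powR ?nnegrE ?invr_ge0 ?(ltW p0)//; lra.
rewrite powR1 in h2.
have h0 : 0 < (1 / 2 : R) `^ p^-1 by rewrite powR_gt0//; lra.
by rewrite /average_gain; apply/andP; split; nra.
Qed.

Lemma harnack_gain_bounds : 0 < kappa <= 1 / 4.
Proof.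
have /andP[c0 c1] := average_gain_bounds.
have CH0 : 0 < 2 * CH by move: CH1; lra.
rewrite /kappa /harnack_gain divr_gt0//= ler_pdivrMr//.
by move: c1 (CH1); lra.
Qed.

Context (ha : h `^ b <= 1 / 4) (hKa : CJ * K * (4 * h `^ b) <= kappa).
Context (z x0 : M) (S r : R) (u : M -> R).
Context (S0 : 0 < S) (hSr : ball z S `<=` ball x0 r).
Context (hSR : (S%:E < sigma%:E * Rbar)%E).
Context (hu : u \in Lfun mu +oo%E) (hharm : harmonic_in mu F E (ball x0 r) u).

Let rho j := S * h ^+ j.
Let B := shrinking_ball z S h.

(** The hypothesis on the earlier balls controls the tail by
    [kappa * (A * e ^+ n.+1)], which is half of what the average provides, so the
    other half is left as a lower bound. *)
Lemma harnack_growth (A s m : R) n : 0 <= A -> `|s| <= 1 ->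
  let v := fun y => s * u y + m in
  (\forall y \ae mu, forall j, (j < n.+1)%N -> B j y -> - (A * e ^+ j) <= v y) ->
  (\forall y \ae mu, B n.+1 y -> 0 <= v y) ->
  ((average_gain * (A * e ^+ n.+1))%:E <=
    ((mu (B n.+2))^-1 * \int[mu]_(y in B n.+2) (v y `^ p)%:E) `^ p^-1)%E ->
  \forall y \ae mu, B n.+2 y -> kappa * (A * e ^+ n.+1) <= v y.
Proof.
move=> A0 s1 v vlow v0 vavg.
have CH0 : 0 < CH by exact: lt_le_trans CH1.
have /andP[h0 h1] := h01.
have /andP[k0 k4] := harnack_gain_bounds.
have e01 : 1 / 2 <= e <= 1 by rewrite /e; apply/andP; split; lra.
have D0 : 0 <= A * e ^+ n.+1 by rewrite mulr_ge0// exprn_ge0//; lra.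
have vL : v \in Lfun mu +oo%E by exact: Lfun_oo_affine.
have [mv _] := (Lfun_ooP mu v).1 vL.
have rhoS j : rho j <= S.
  by have := shrinking_radius_le (ltW S0) (_ : 0 <= h <= 1) (leq0n j);
    rewrite expr0 mulr1; apply; rewrite !ltW.
have rho0 j : 0 < rho j by rewrite mulr_gt0// exprn_gt0.
have vsup : superharmonic_in mu F E (cst 0) (B n.+1) v.
  apply: harmonic_superharmonic hharm; [exact: df_domain hE|exact: df_form hE|].
  apply: subset_trans hSr; apply: sub_mball.
  by rewrite mdistxx add0r rhoS.
have rhoE : rho n.+2 = h * rho n.+1 by rewrite /rho exprS; ring.
have rho_delta : rho n.+2 <= delta * rho n.+1 by rewrite rhoE ler_wpM2r// ltW.
have rhoR : ((rho n.+1)%:E < sigma%:E * Rbar)%E.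
  by apply: le_lt_trans hSR; rewrite lee_fin.
have := le_trans vavg (hH (z := z) (rho0 n.+2) rho_delta rhoR vL v0 vsup).
have hneg : \forall y \ae mu, forall j, (j < n.+1)%N -> B j y ->
    `|neg_part v y| <= A * e ^+ j.
  apply: filterS vlow => y hy j jn By; have := hy j jn By => vy.
  rewrite /neg_part ger0_norm ?le_max ?lexx// ge_max lerNl vy andbT.
  by rewrite mulr_ge0// exprn_ge0//; lra.
have mneg : measurable_fun setT (neg_part v).
  by apply: measurable_maxr => //; exact: measurableT_comp.
have htail := tail_shrinking S0 A0 e01 ha mneg hneg.
have {}htail := le_trans htail (_ : _ <= (kappa * (A * e ^+ n.+1))%:E)%E.
have {}htail := htail ltac:(by rewrite lee_fin ler_wpM2r).
move=> /le_trans /(_ (lee_wpmul2l _ (leeD2l _ htail))) => /(_ ltac:(by rewrite lee_fin; lra)).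
have gainE : average_gain = 2 * CH * kappa.
  by rewrite /kappa /harnack_gain mulrC divfK// gt_eqF// mulr_gt0//; lra.
move: D0; set D := A * e ^+ n.+1 => D0.
set ei := ess_inf_on _ _ _ => hei.
(* a priori the essential infimum may be infinite *)
have : ((kappa * D)%:E <= ei)%E.
  case: ei hei => [t| |].
  - rewrite -EFinD -EFinM !lee_fin gainE => h2.
    by rewrite -(ler_pM2l CH0); nra.
  - by rewrite leey.
  - by rewrite addNye gt0_muleNy ?lte_fin// leeNy_eq.
move=> /ess_infP; apply: filterS => y; rewrite /patch => + By.
by rewrite mem_set// lee_fin.
Qed.

(** The function stays within [A * e ^+ j] of both ends of the current range
    [[m, m + A * e ^+ n]] on every earlier ball.  This is what the tail estimate
    needs for [u - m] and for [m + A * e ^+ n - u]; for [j = n] it is the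
    oscillation bound itself.  It involves the last lower bound [m] only, so no
    history of nested ranges has to be carried. *)
Definition oscillation_bound (A : R) (n : nat) (m : R) : Prop :=
  \forall y \ae mu, forall j, (j <= n)%N -> B j y ->
    m + A * e ^+ n - A * e ^+ j <= u y <= m + A * e ^+ j.

(** Either the lower end of the range moves up or the upper end moves down by
    [kappa * (A * e ^+ n.+1)]; the new range lies inside the old one, so the
    bounds on the earlier balls persist. *)
Lemma oscillation_step (A m : R) n : 0 <= A -> oscillation_bound A n.+1 m ->
  exists m', oscillation_bound A n.+2 m'.
Proof.
move=> A0 hm; set D := A * e ^+ n.+1.
have /andP[h0 h1] := h01.
have /andP[k0 k4] := harnack_gain_bounds.
have e01 : 1 / 2 <= e <= 1 by rewrite /e; apply/andP; split; lra.
have D0 : 0 <= D by rewrite mulr_ge0// exprn_ge0//; lra.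
have [mu_ _] := (Lfun_ooP mu u).1 hu.
have rho0 j : 0 < rho j by rewrite mulr_gt0// exprn_gt0.
have Bn : B n.+2 `<=` B n.+1.
  apply: sub_mball; rewrite mdistxx add0r.
  by apply: shrinking_radius_le; rewrite ?(ltW h0) ?(ltW h1) ?(ltW S0).
have [v vE vavg] : exists2 v, v = (fun y => 1 * u y - m) \/
      v = (fun y => (- 1) * u y + (m + D)) &
    ((average_gain * D)%:E <=
      ((mu (B n.+2))^-1 * \int[mu]_(y in B n.+2) (v y `^ p)%:E) `^ p^-1)%E.
  apply: lower_power_average => //.
  - exact: measurable_mball.
  - exact: (mu_mball_gt0 hM z (rho0 n.+2)).
  - exact: (mu_mball_lty hM z (rho0 n.+2)).
  - by apply: measurable_funD => //; apply: measurable_funM.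
  - by apply: measurable_funD => //; apply: measurable_funM.
  - by apply: aeW => y _; lra.
have DE : A * e ^+ n.+2 = D - kappa * D by rewrite exprS /D /e; ring.
have s1 : `|1 : R| <= 1 by rewrite normr1.
have s2 : `|-1 : R| <= 1 by rewrite normrN1.
have coarse m' : m <= m' <= m + kappa * D ->
    (\forall y \ae mu, B n.+2 y -> m' <= u y <= m' + A * e ^+ n.+2) ->
    oscillation_bound A n.+2 m'.
  move=> /andP[m1 m2] fine_; apply: filterS2 hm fine_ => y hy fy j.
  rewrite leq_eqVlt => /predU1P[->|jn] By.
    by have := fy By; rewrite addrK.
  have /andP[y1 y2] := hy j jn By.
  by apply/andP; split; move: y1 y2; rewrite ?DE -/D; nra.
have low (s c : R) : (s = 1 /\ c = - m) \/ (s = -1 /\ c = m + D) ->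
    (\forall y \ae mu, forall j, (j < n.+1)%N -> B j y ->
       - (A * e ^+ j) <= s * u y + c) /\
    (\forall y \ae mu, B n.+1 y -> 0 <= s * u y + c).
  move=> sc; split; apply: filterS hm => y hy.
    move=> j jn By; have /andP[] := hy j (ltnW jn) By; rewrite -/D.
    by case: sc => -[-> ->]; lra.
  move=> By; have /andP[] := hy n.+1 (leqnn _) By; rewrite -/D.
  by case: sc => -[-> ->]; lra.
case: vE => vE; rewrite vE in vavg.
  exists (m + kappa * D); apply: coarse; first by apply/andP; split; nra.
  have [l1 l2] := low 1 (- m) (or_introl (conj erefl erefl)).
  have := harnack_growth A0 s1 l1 l2 vavg.
  apply: filterS2 hm => y hy ky By; have := ky By.
  have /andP[] := hy n.+1 (leqnn _) (Bn _ By); rewrite DE -/D => y1 y2 y3.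
  by apply/andP; split; lra.
exists m; apply: coarse; first by apply/andP; split; nra.
have [l1 l2] := low (-1) (m + D) (or_intror (conj erefl erefl)).
have := harnack_growth A0 s2 l1 l2 vavg.
apply: filterS2 hm => y hy ky By; have := ky By.
have /andP[] := hy n.+1 (leqnn _) (Bn _ By); rewrite DE -/D => y1 y2 y3.
by apply/andP; split; lra.
Qed.

(** The induction starts at index 1, with range [[- L, L]] on the whole space: as
    index 0 is the whole space, the first ball is that of index 1.  The amplitude
    [2 * L / e] makes the range at index 1 exactly [2 * L]. *)
Lemma oscillation_decay (L : R) n : (\forall y \ae mu, `|u y| <= L) -> 0 <= L ->
  exists m, \forall y \ae mu, ball z (S * h ^+ n) y ->
    m <= u y <= m + 2 * L / e * e ^+ n.
Proof.
move=> uL L0; have /andP[k0 k4] := harnack_gain_bounds.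
have e0 : 0 < e by rewrite /e; lra.
have A0 : 0 <= 2 * L / e by rewrite divr_ge0 ?mulr_ge0// ltW.
have AL : 2 * L <= 2 * L / e.
  by rewrite ler_pdivlMr// ler_piMr ?mulr_ge0// /e; lra.
case: n => [|n].
  exists (- L); apply: filterS uL => y; rewrite ler_norml => /andP[y1 y2] _.
  by rewrite expr0 mulr1; apply/andP; split; lra.
suff [m hm] : exists m, oscillation_bound (2 * L / e) n.+1 m.
  exists m; apply: filterS hm => y hy By.
  by have := hy n.+1 (leqnn _) By; rewrite addrK.
elim: n => [|n [m hm]]; last exact: oscillation_step hm.
exists (- L); apply: filterS uL => y; rewrite ler_norml => /andP[y1 y2] j.
have Ae : 2 * L / e * e = 2 * L by rewrite divfK// gt_eqF.
case: j => [|[|//]] _ _; rewrite ?expr0 ?expr1 ?mulr1 Ae; apply/andP; split; lra.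
Qed.

End oscillation.

(** * From decay of oscillation to Hölder continuity *)

Section hoelder_from_decay.
Context (R : realType).

Lemma geometric_bracket (h q : R) : 0 < h < 1 -> 0 < q <= 1 ->
  exists n : nat, h ^+ n.+1 < q <= h ^+ n.
Proof.
move=> /andP[h0 h1] /andP[q0 q1].
have ex : exists n : nat, h ^+ n.+1 < q.
  have /cvgrPdist_lt/(_ q q0)[N _ HN] : h ^+ n @[n --> \oo] --> (0 : R).
    by apply: cvg_expr; rewrite gtr0_norm.
  exists N; have := HN N.+1 (leqnSn N).
  by rewrite /= sub0r normrN gtr0_norm// exprn_gt0.
exists (ex_minn ex); case: ex_minnP => n -> nmin /=.
case: n nmin => [|n] nmin; first by rewrite expr0.
by rewrite leNgt; apply/negP => /nmin; rewrite ltnn.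
Qed.

(** The exponent is [ln e / ln h]; it is at most 1 because [h <= 1 / 2 <= e]. *)
Lemma decay_exponent (h e : R) : 0 < h <= 1 / 2 -> 1 / 2 <= e < 1 ->
  exists2 g : R, 0 < g <= 1 & e = h `^ g.
Proof.
move=> /andP[h0 h2] /andP[e2 e1].
have e0 : 0 < e by lra.
have lh : ln h < 0 by apply: ln_lt0; apply/andP; split; lra.
have le0 : ln e < 0 by apply: ln_lt0; apply/andP; split; lra.
have lhe : ln h <= ln e by rewrite ler_ln ?posrE//; lra.
exists (ln e / ln h).
  by rewrite ler_ndivrMr// mul1r lhe andbT -mulrNN -invrN divr_gt0 ?oppr_gt0.
rewrite /powR gt_eqF// divfK ?lt_eqF//.
by rewrite lnK ?posrE.
Qed.

Context (d : measure_display) (M : borelMetricType R d).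
Context (mu : {measure set M -> \bar R}).

Lemma ae_countable (D : set M) (P : M -> M -> Prop) : countable D ->
  (forall z, D z -> \forall y \ae mu, P z y) ->
  \forall y \ae mu, forall z, D z -> P z y.
Proof.
move=> /countable_injP[f finj] hP.
have : \forall y \ae mu, forall i, forall z, D z -> f z = i -> P z y.
  apply: ae_foralln => i.
  have [[z0 [Dz0 fz0]]|no] := pselect (exists z, D z /\ f z = i).
    apply: filterS (hP z0 Dz0) => y Py z Dz fz.
    by rewrite (finj z z0) ?inE// fz fz0.
  by apply: aeW => y z Dz fz; exfalso; apply: no; exists z.
by apply: filterS => y hy z Dz; exact: hy Dz erefl.
Qed.

(** For [t = d(x, y)] choose [n] with [S h^(n+1) < 2 t <= S h^n], [S = r / 2], and
    a centre [z] of the dense set within [t] of [x]: both points lie in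
    [B(z, S h^n)], where the oscillation is at most
    [A (h^g)^n <= A / h^g * (4 t / r)^g].  The radius [r / 8] ensures [2 t <= S],
    and [z] stays within [3 / 8 * r] of [x0]. *)
Lemma hoelder_of_decay (u : M -> R) (x0 : M) (r h g A : R) :
  separable_space M -> 0 < r -> 0 < h < 1 -> 0 < g <= 1 -> 0 <= A ->
  (forall z n, ball x0 (3 / 8 * r) z ->
     exists m, \forall y \ae mu, ball z (r / 2 * h ^+ n) y ->
       m <= u y <= m + A * (h `^ g) ^+ n) ->
  exists2 N : set M, mu.-negligible N &
    forall x y : M, ball x0 (1 / 8 * r) x -> ball x0 (1 / 8 * r) y ->
      ~ N x -> ~ N y ->
      `|u x - u y| <= A / h `^ g * 4 * (mdist x y / r) `^ g.
Proof.
move=> [D cD dD] r0 h01 /andP[g0 g1] A0 hdec.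
have /andP[h0 h1] := h01.
have hg0 : 0 < h `^ g by exact: powR_gt0.
pose m z n : R := if pselect (ball x0 (3 / 8 * r) z) is left H
  then sval (cid (hdec z n H)) else 0.
have hm z n : ball x0 (3 / 8 * r) z ->
    \forall y \ae mu, ball z (r / 2 * h ^+ n) y ->
      m z n <= u y <= m z n + A * (h `^ g) ^+ n.
  by move=> Bz; rewrite /m; case: pselect => // H; case: cid.
have hae : \forall y \ae mu, forall z, D z -> ball x0 (3 / 8 * r) z ->
    forall n, ball z (r / 2 * h ^+ n) y ->
      m z n <= u y <= m z n + A * (h `^ g) ^+ n.
  apply: ae_countable cD _ => z _.
  have [Bz|nBz] := pselect (ball x0 (3 / 8 * r) z); last by apply: aeW.
  by apply: filterS (ae_foralln (fun n => hm z n Bz)) => y hy _.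
exists (~` [set y | forall z, D z -> ball x0 (3 / 8 * r) z ->
    forall n, ball z (r / 2 * h ^+ n) y ->
      m z n <= u y <= m z n + A * (h `^ g) ^+ n]); first exact: hae.
move=> x y; rewrite !ballEmdist /= => x0x x0y /contrapT ux /contrapT uy.
have [->|xy] := eqVneq x y.
  by rewrite subrr normr0 !mulr_ge0 ?powR_ge0// invr_ge0 ltW.
set t := mdist x y; have t0 : 0 < t by rewrite /t mdist_gt0.
have tr : t < r / 4.
  by have := metric_triangle x x0 y; rewrite [mdist x x0]metric_sym -/t; lra.
have [n /andP[n1 n2]] : exists n : nat, h ^+ n.+1 < 4 * (t / r) <= h ^+ n.
  apply: geometric_bracket => //; rewrite mulrA; apply/andP; split.
    by rewrite divr_gt0// mulr_gt0.
  by rewrite ler_pdivrMr//; lra.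
have tn : 2 * t <= r / 2 * h ^+ n.
  by move: n2; rewrite mulrA ler_pdivrMr//; lra.
have [z [xz Dz]] : (ball x t `&` D) !=set0.
  by apply: dD; [exists x; exact: ballxx|exact: open_mball].
move: xz; rewrite ballEmdist /= => xz.
have x0z : mdist x0 z < 3 / 8 * r.
  by have := metric_triangle x0 x z; lra.
have zx : ball z (r / 2 * h ^+ n) x by rewrite ballEmdist /= metric_sym; lra.
have zy : ball z (r / 2 * h ^+ n) y.
  rewrite ballEmdist /=; have := metric_triangle z x y.
  by rewrite [mdist z x]metric_sym -/t; lra.
have /andP[ux1 ux2] := ux z Dz x0z n zx.
have /andP[uy1 uy2] := uy z Dz x0z n zy.
apply: (@le_trans _ _ (A * (h `^ g) ^+ n)).
  by rewrite ler_norml; apply/andP; split; lra.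
rewrite -!mulrA ler_wpM2l// ler_pdivlMl//.
rewrite -exprS -expr_powR ?(ltW h0)//.
have tr0 : 0 <= t / r by rewrite divr_ge0 ?ltW.
apply: (@le_trans _ _ ((4 * (t / r)) `^ g)).
  apply: ge0_ler_powR (ltW n1); first exact: ltW.
    by rewrite nnegrE exprn_ge0// ltW.
  by rewrite nnegrE mulr_ge0.
rewrite powRM// ler_wpM2r ?powR_ge0//.
by rewrite -[leRHS]powRr1// ler_powR//; lra.
Qed.

End hoelder_from_decay.

(** * The theorem *)

(** As [h `^ b] tends to 0 with [h], finitely many smallness conditions on it can
    be met at once. *)
Lemma ratio_choice (R : realType) (delta kappa K CJ b : R) :
  0 < delta -> 0 < kappa -> 0 < K -> 0 <= CJ -> 0 < b ->
  exists h : R, [/\ 0 < h <= 1 / 2, h <= delta, h `^ b <= 1 / 4 &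
    CJ * K * (4 * h `^ b) <= kappa].
Proof.
move=> delta0 kappa0 K0 CJ0 b0.
pose c := Num.min (1 / 4) (kappa / (4 * K * (CJ + 1))).
have den0 : 0 < 4 * K * (CJ + 1) by rewrite !mulr_gt0//; lra.
have c0 : 0 < c by rewrite lt_min divr_gt0//= divr_gt0.
pose h := Num.min (Num.min (1 / 2) delta) (c `^ b^-1).
have h0 : 0 < h by rewrite !lt_min delta0 powR_gt0// divr_gt0.
have hb : h `^ b <= c.
  have -> : c = (c `^ b^-1) `^ b.
    by rewrite -powRrM mulVf ?gt_eqF// powRr1// ltW.
  apply: ge0_ler_powR; [exact: ltW|by rewrite nnegrE ltW|by rewrite nnegrE powR_ge0|].
  by rewrite ge_min lexx orbT.
exists h; split.
- by rewrite h0 /= !ge_min lexx.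
- by rewrite !ge_min lexx orbT.
- by apply: le_trans hb _; rewrite ge_min lexx.
have : h `^ b <= kappa / (4 * K * (CJ + 1)).
  by apply: le_trans hb _; rewrite ge_min lexx orbT.
rewrite ler_pdivlMr// => hk.
have hb0 := powR_ge0 h b.
have : 0 <= h `^ b * (4 * K) by rewrite !mulr_ge0// ltW.
by nra.
Qed.

Theorem lemma6p2 (R : realType) (d : measure_display) (M : borelMetricType R d)
  (mu : {measure set M -> \bar R}) (Rbar : \bar R) (w : M -> R -> R)
  (F : set (M -> R)) (E : (M -> R) -> (M -> R) -> R)
  (J : {measure set (M * M) -> \bar R}) (k : R.-ker M ~> M) (sigma : R)
  (hM : metric_measure_space mu)
  (hRbar : (0 < Rbar <= diam M)%E)
  (hw : scaling_function w)
  (hE : dirichlet_form mu F E)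
  (hreg : regular_form mu F E)
  (hkill : without_killing mu F E J)
  (hwEH : wEH mu F E w k Rbar sigma)
  (hTJ : TJ mu w J k) :
  exists C theta eps : R,
    [/\ 0 < C, 0 < theta <= 1, 0 < eps < 1 &
      forall (x0 : M) (r : R), 0 < r -> (r%:E < sigma%:E * Rbar)%E ->
      forall u : M -> R, u \in Lfun mu +oo%E ->
        harmonic_in mu F E (ball x0 r) u ->
      exists2 N : set M, mu.-negligible N &
        forall x y : M, ball x0 (eps * r) x -> ball x0 (eps * r) y ->
          ~ N x -> ~ N y ->
          `|u x - u y| <=
            C * (mdist x y / r) `^ theta * fine 'N[mu]_+oo[EFin \o u]].
Proof.
have [K [b [K0 b0 hK]]] := scaling_ratio hw.
have [hJk [CJ CJ0 hCJ]] := hTJ.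
have [hJ _] := hkill.
have [p [delta [CH [p0 delta0 CH1 hH]]]] := wEH_homogeneous hwEH.
have /andP[kappa0 kappa4] := harnack_gain_bounds p0 CH1.
have [h [/andP[h0 h2] hdelta h4 hkappa]] := ratio_choice delta0 kappa0 K0 CJ0 b0.
have h01 : 0 < h < 1 by apply/andP; split; lra.
set e := 1 - harnack_gain p CH.
have e0 : 0 < e by rewrite /e; lra.
have [g g01 eg] : exists2 g : R, 0 < g <= 1 & e = h `^ g.
  by apply: decay_exponent; rewrite ?h0// /e; apply/andP; split; lra.
exists (2 / e / e * 4), g, (1 / 8); split => //.
- by rewrite mulr_gt0// !divr_gt0.
- by apply/andP; split; lra.
move=> x0 r r0 rR u hu hharm.
set L := fine 'N[mu]_+oo[EFin \o u]%E.
have L0 : 0 <= L by rewrite fine_ge0// Lnorm_ge0.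
have A0 : 0 <= 2 * L / e by rewrite divr_ge0 ?mulr_ge0// ltW.
have [N N0 hN] : exists2 N : set M, mu.-negligible N &
    forall x y : M, ball x0 (1 / 8 * r) x -> ball x0 (1 / 8 * r) y ->
      ~ N x -> ~ N y ->
      `|u x - u y| <= 2 * L / e / h `^ g * 4 * (mdist x y / r) `^ g.
  apply: hoelder_of_decay => //; first exact: mms_separable hM.
  move=> z n x0z; rewrite -eg.
  have S0 : 0 < r / 2 by rewrite divr_gt0.
  have hSr : ball z (r / 2) `<=` ball x0 r.
    by move: x0z; rewrite ballEmdist /= => x0z; apply: sub_mball; lra.
  have hSR : ((r / 2)%:E < sigma%:E * Rbar)%E.
    by apply: le_lt_trans rR; rewrite lee_fin; lra.
  exact: (oscillation_decay hw hJ hJk K0 CJ0 h01 hK hCJ hM hE p0 hdelta CH1 hH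
    h4 hkappa S0 hSr hSR hu hharm n (ae_le_Lnorm_oo hu) L0).
exists N => // x y Bx By Nx Ny; apply: le_trans (hN x y Bx By Nx Ny) _.
rewrite -eg le_eqVlt; apply/orP; left; apply/eqP.
by ring.
Qed.
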